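(* Let $x\in(0,1)$ be an irrational number and let $n$ be a positive integer. If $k=k(x,n)$ is the only positive integer such that $$q_k(x)+q_{k-1}(x)\le n+1<q_{k+1}(x)+q_k(x),$$ then $$L_n(x,\mathcal F,\mathcal{CF})=k.$$
   Context: $\mathbb N$ includes $0$. For an irrational $x\in(0,1)$ with continued fraction expansion $x=[0;a_1,a_2,\dots]$, set $p_{-1}=1,p_0=0,q_{-1}=0,q_0=1$, $p_n=a_np_{n-1}+p_{n-2}$, $q_n=q_n(x)=a_nq_{n-1}+q_{n-2}$. $\mathcal{CF}$ is the continued fraction sequence of partitions of $[0,1]$ into open intervals: its depth-$0$ partition is $\{(0,1)\}$, and its depth-$n$ interval containing the irrational $x$ ($n\ge1$) is the open interval $I_n^{\mathcal{CF}}(x)$ with endpoints $\frac{p_n}{q_n}$ and $\frac{p_n+p_{n-1}}{q_n+q_{n-1}}$. $\mathcal F=\{F_n\}_{n\in\mathbb N}$ is the Farey sequence of partitions: $F_n$ consists of the open intervals between consecutive elements of $\{p/q:0\le p\le q\le n+1,\ q\ge1,\ \gcd(p,q)=1\}$, and $I_n^{\mathcal F}(x)$ is the interval of $F_n$ containing $x$. The Lochs index is $L_n(x,\mathcal F,\mathcal{CF})=\sup\{\ell\in\mathbb N: I_n^{\mathcal F}(x)\subseteq I_\ell^{\mathcal{CF}}(x)\}$. *)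

(* Defs.v *)
From HB Require Import structures.
From mathcomp Require Import all_boot all_order all_algebra.
From mathcomp Require Import all_classical all_reals all_analysis.

Set Implicit Arguments.
Unset Strict Implicit.
Unset Printing Implicit Defensive.

Import Order.TTheory GRing.Theory Num.Theory.

Local Open Scope classical_set_scope.
Local Open Scope ring_scope.

Section ContinuedFractions.
Variable R : realType.
Implicit Types (x : R) (n : nat).

Definition gauss_map x : R := x^-1 - (Num.floor x^-1)%:~R.

(* The partial quotient a_n of x = [0; a_1, a_2, ...]; meaningful for n >= 1
   and x an irrational of (0, 1). *)
Definition cf_digit x n : nat := Num.truncn (iter n.-1 gauss_map x)^-1.

(* The solution of s_n = a_n s_(n-1) + s_(n-2) (n >= 1) with s_(-1) = u and
   s_0 = v. *)
Fixpoint cf_rec (a : nat -> nat) (u v n : nat) : nat :=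
  match n with
  | 0 => v
  | m.+1 => a n * cf_rec a u v m + (if m is m'.+1 then cf_rec a u v m' else u)
  end%N.

Definition cf_p x n : nat := cf_rec (cf_digit x) 1 0 n.

Definition cf_q x n : nat := cf_rec (cf_digit x) 0 1 n.

(* In depth n >= 1 the two endpoints come in an order depending on the parity
   of n, hence the min and max. *)
Definition cf_interval x n : set R :=
  if n is m.+1 then
    let a := (cf_p x n)%:R / (cf_q x n)%:R in
    let b := (cf_p x n + cf_p x m)%N%:R / (cf_q x n + cf_q x m)%N%:R in
    `]Num.min a b, Num.max a b[%classic
  else `]0, 1[%classic.

(* Partitions of [0, 1] into open intervals (up to endpoints) are represented
   by the set of their intervals. *)
Definition CF n : set (set R) :=
  [set cf_interval x n | x in [set x | 0 < x < 1 /\ irrational x]].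

Definition farey_points n : set R :=
  [set r | exists p q : nat,
    [/\ (p <= q <= n.+1)%N, (1 <= q)%N, coprime p q & r = p%:R / q%:R]].

Definition Farey n : set (set R) :=
  [set I : set R | exists a b : R,
    [/\ farey_points n a, farey_points n b, a < b,
        (forall c, farey_points n c -> ~~ (a < c < b)) & I = `]a, b[%classic]].

(* As the members of a partition P are pairwise disjoint, this union is the
   unique member of P containing x, when there is one. *)
Definition interval_of (P : set (set R)) x : set R :=
  \bigcup_(I in [set I | P I /\ I x]) I.

(* The supremum is taken in the extended reals, so that the index of a point
   may be infinite. *)
Definition Lochs_index n x (P Q : nat -> set (set R)) : \bar R :=
  ereal_sup [set (l%:R)%:E |
    l in [set l : nat | interval_of (P n) x `<=` interval_of (Q l) x]].

End ContinuedFractions.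

Arguments CF {R} n.
Arguments Farey {R} n.

(* Main.v *)
(** Write [x = (p_l + t p_(l-1)) / (q_l + t q_(l-1))] where [t] in (0, 1) is the
    [l]-th iterate of [x] under the Gauss map.  The endpoints of the depth-[l]
    interval are the values at [t = 0] and [t = 1], and they are unimodular
    neighbours.  If [q_l + q_(l-1) <= n + 1], both endpoints are Farey points of
    order [n], so they cannot cut the Farey interval of [x], which is therefore
    contained in the depth-[l] interval.  If [q_l + q_(l-1) > n + 1], a Farey
    interval around [x] that is contained in the depth-[l] interval would have an
    endpoint that differs from [p_l / q_l] and lies in the closed depth-[l]
    interval; by unimodularity its denominator would be at least
    [q_l + q_(l-1)]. *)

Require Import Defs.
From mathcomp Require Import all_boot all_order all_algebra.
From mathcomp Require Import all_classical all_reals all_analysis.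
From mathcomp Require Import ring.

Import Order.TTheory GRing.Theory Num.Theory.

Local Open Scope ring_scope.

(** * Convergents: determinant identity and growth of the denominators *)

Section Recurrence.
Set Implicit Arguments.
Unset Strict Implicit.

(* [s_(n-1)], where [s_(-1) = u]. *)
Definition cf_prev (a : nat -> nat) (u v n : nat) : nat :=
  if n is m.+1 then cf_rec a u v m else u.

Lemma cf_recS a u v n :
  cf_rec a u v n.+1 = (a n.+1 * cf_rec a u v n + cf_prev a u v n)%N.
Proof. by []. Qed.

Lemma eq_cf_rec a b u v n :
  (forall i, (i < n)%N -> a i.+1 = b i.+1) ->
  cf_rec a u v n = cf_rec b u v n /\ cf_prev a u v n = cf_prev b u v n.
Proof.
elim: n => [//|n IHn] ab.
have [IH1 IH2] := IHn (fun i lin => ab i (ltnW lin)).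
by split=> //; rewrite !cf_recS IH1 IH2 ab.
Qed.

(** One step of the recurrence multiplies by a matrix of determinant -1. The general ring serves
    both signs in [R] and integrality in [int]. *)
Lemma cf_det (A : comPzRingType) a n :
  (cf_prev a 1 0 n)%:R * (cf_rec a 0 1 n)%:R
    - (cf_rec a 1 0 n)%:R * (cf_prev a 0 1 n)%:R = (-1) ^+ n :> A.
Proof.
elim: n => [|n IHn]; first by rewrite /= mulr1 mul0r subr0.
by rewrite !cf_recS [cf_prev _ _ _ n.+1]/= exprS -IHn !natrD !natrM; ring.
Qed.

Lemma coprime_det (p q u v n : nat) :
  u%:R * q%:R - p%:R * v%:R = (-1) ^+ n :> int -> coprime p q.
Proof.
rewrite !natz /coprime -dvdn1 => det.
have : ((gcdn p q)%:Z %| (-1) ^+ n)%Z.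
  rewrite -det rpredB//.
    by apply: dvdz_mull; rewrite dvdzE dvdn_gcdr.
  by apply: dvdz_mulr; rewrite dvdzE dvdn_gcdl.
by rewrite dvdzE abszX exp1n.
Qed.

Variable a : nat -> nat.
Hypothesis a_gt0 : forall i, (0 < a i.+1)%N.

Local Notation P n := (cf_rec a 1 0 n).
Local Notation P' n := (cf_prev a 1 0 n).
Local Notation Q n := (cf_rec a 0 1 n).
Local Notation Q' n := (cf_prev a 0 1 n).

Lemma cf_q_gt0 n : (0 < Q n)%N.
Proof. by elim: n => [//|n IHn]; rewrite cf_recS addn_gt0 muln_gt0 a_gt0 IHn. Qed.

Lemma leq_cf_qS n : (Q n <= Q n.+1)%N.
Proof. by rewrite cf_recS (leq_trans _ (leq_addr _ _))// leq_pmull. Qed.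

(** The recurrence has order two, so the induction carries two consecutive indices. *)
Lemma leq_cf_p_q n : (P n <= Q n)%N /\ (P n.+1 <= Q n.+1)%N.
Proof.
elim: n => [|n [IH1 IH2]]; first by rewrite /= muln0 muln1 addn0 a_gt0.
by split=> //; rewrite !cf_recS leq_add// leq_mul2l IH2 orbT.
Qed.

Lemma leq_cf_q_sum m n : (m <= n)%N -> (Q m.+1 + Q m <= Q n.+1 + Q n)%N.
Proof.
move=> lemn; apply: (@homo_leq _ (fun i => (Q i.+1 + Q i)%N) leq) => //.
  exact: leq_trans.
by move=> i; rewrite leq_add// leq_cf_qS.
Qed.

(** * Moebius parametrization of the depth-[n] interval *)

Section Moebius.
Variable R : realFieldType.
Implicit Types t x : R.

(** For [n >= 1] this is the value of [0; a_1, ..., a_n + t]; for [n = 0] it is [t]. *)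
Definition moebius n t : R :=
  ((P n)%:R + t * (P' n)%:R) / ((Q n)%:R + t * (Q' n)%:R).

Lemma moebius_den_gt0 n t : 0 <= t -> 0 < (Q n)%:R + t * (Q' n)%:R :> R.
Proof.
by move=> t0; rewrite ltr_wpDr ?mulr_ge0 ?ler0n// ltr0n cf_q_gt0.
Qed.

Lemma moebiusS n t : 0 <= t ->
  moebius n.+1 t = moebius n ((a n.+1)%:R + t)^-1.
Proof.
move=> t0.
have at0 : 0 < (a n.+1)%:R + t :> R by rewrite ltr_wpDr// ltr0n.
have := moebius_den_gt0 n.+1 t0.
have := @moebius_den_gt0 n ((a n.+1)%:R + t)^-1.
rewrite invr_ge0 (ltW at0) => /(_ isT).
rewrite /moebius !cf_recS /= !natrD !natrM => d1 d2.
have d3 : 0 < (Q n)%:R * ((a n.+1)%:R + t) + (Q' n)%:R.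
  by move: d2; congr (0 < _); ring.
field; rewrite ?lt0r_neq0//.
Qed.

(* The two conditions say that [x] is strictly between [p_n / q_n] and
   [(p_n + p_(n-1)) / (q_n + q_(n-1))], whose order depends on the parity
   of [n]. *)
Definition between n x : bool :=
  (0 < (-1) ^+ n * (x * (Q n)%:R - (P n)%:R)) &&
  (0 < (-1) ^+ n * ((P n + P' n)%N%:R - x * (Q n + Q' n)%N%:R)).

Lemma moebius_between n t : 0 < t < 1 -> between n (moebius n t).
Proof.
move=> /andP[t0 t1]; have d0 := moebius_den_gt0 n (ltW t0).
have ee : (-1) ^+ n * ((P' n)%:R * (Q n)%:R - (P n)%:R * (Q' n)%:R) = 1 :> R.
  by rewrite cf_det -expr2 sqrr_sign.
rewrite /between /moebius !natrD.
pose e : R := (-1) ^+ n; rewrite -/e in ee *; move: e ee => e ee.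
move: (P n)%:R (P' n)%:R (Q n)%:R (Q' n)%:R => p p' q q' in d0 ee *.
apply/andP; split.
  (* The determinant turns the two signed differences into [t] and [1 - t] over a common
     denominator. *)
  rewrite (_ : e * _ = t / (q + t * q')); first by rewrite divr_gt0.
  by rewrite -[RHS]mul1r -ee; field; rewrite lt0r_neq0.
rewrite (_ : e * _ = (1 - t) / (q + t * q')).
  by rewrite divr_gt0 ?subr_gt0.
by rewrite -[RHS]mul1r -[X in _ = X * _]ee; field; rewrite lt0r_neq0.
Qed.

Lemma between_moebius n x :
  between n x -> exists2 t, 0 < t < 1 & x = moebius n t.
Proof.
rewrite /between; set A := (X in 0 < X) => /andP[A0].
set B := (X in 0 < X) => B0.
have AB0 : 0 < A + B by rewrite addr_gt0.
(* For [x = moebius n t], [A] is to [B] as [t] is to [1 - t], which forces this witness. *)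
exists (A / (A + B)).
  by rewrite divr_gt0//= ltr_pdivrMr// mul1r ltrDl.
have t0 : 0 <= A / (A + B) by rewrite divr_ge0// ltW.
apply/eqP; rewrite /moebius eq_sym -subr_eq0; apply/eqP.
have d0 := moebius_den_gt0 n t0.
have e0 : (-1) ^+ n != 0 :> R by rewrite signr_eq0.
have ABE : A + B = (-1) ^+ n * ((P' n)%:R - x * (Q' n)%:R).
  by rewrite /A /B !natrD; ring.
have tE : A / (A + B) * ((P' n)%:R - x * (Q' n)%:R) = x * (Q n)%:R - (P n)%:R.
  apply: (mulfI e0); rewrite mulrCA -ABE divfK ?lt0r_neq0//.
set t := A / _ in d0 tE *.
apply: (mulIf (lt0r_neq0 d0)); rewrite mul0r mulrBl divfK ?lt0r_neq0//.
by move: tE => /eqP; rewrite -subr_eq0 => /eqP tE; rewrite -[RHS]tE; ring.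
Qed.

(** In the unimodular basis (p_n + p_(n-1), q_n + q_(n-1)), (p_n, q_n), the vector (u, v) has
    integer coordinates [A >= 1] and [B >= 0]. The mediant itself, where [B = 0], is allowed. *)
Lemma between_den n x : 0 < (-1) ^+ n * (x * (Q n)%:R - (P n)%:R) ->
  0 <= (-1) ^+ n * ((P n + P' n)%N%:R - x * (Q n + Q' n)%N%:R) ->
  forall u v : nat, (0 < v)%N -> x = u%:R / v%:R -> (Q n + Q' n <= v)%N.
Proof.
move=> x1 x2 u v v0 xE.
have v0' : 0 < v%:R :> R by rewrite ltr0n.
pose A : int := (-1) ^+ n * (u%:R * (Q n)%:R - (P n)%:R * v%:R).
pose B : int := (-1) ^+ n * ((P n + P' n)%N%:R * v%:R - u%:R * (Q n + Q' n)%N%:R).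
have A0 : 0 < A.
  rewrite -(ltr0z R) /A rmorphM rmorphXn rmorphN1 rmorphB !rmorphM /= !rmorph_nat.
  rewrite -(pmulr_rgt0 _ v0') in x1; move: x1; congr (0 < _).
  by rewrite xE; field; exact: lt0r_neq0.
have B0 : 0 <= B.
  rewrite -(ler0z R) /B rmorphM rmorphXn rmorphN1 rmorphB !rmorphM /= !rmorph_nat.
  rewrite -(pmulr_rge0 _ v0') in x2; move: x2; congr (0 <= _).
  by rewrite xE; field; exact: lt0r_neq0.
have vE : v%:R = (Q n + Q' n)%N%:R * A + (Q n)%:R * B :> int.
  rewrite -[LHS]mul1r -(sqrr_sign int n) expr2 -[X in _ * X * _](cf_det int a).
  by rewrite /A /B !natrD; ring.
rewrite -(ler_nat int) vE; apply: ler_wpDr; first by rewrite mulr_ge0.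
by rewrite ler_peMr// -gtz0_ge1.
Qed.

End Moebius.

End Recurrence.

(** * Gauss map orbits and digits *)

Section GaussOrbit.
Set Implicit Arguments.
Unset Strict Implicit.
Variable R : realType.
Implicit Types (x y t : R) (n l : nat).

Local Notation orbit n x := (iter n (@gauss_map R) x).

Lemma gauss_map_itv x : 0 < x < 1 -> irrational x ->
  0 < gauss_map x < 1 /\ irrational (gauss_map x).
Proof.
move=> /andP[x0 x1] irrx.
have irrg : irrational (gauss_map x).
  move=> [r _ rE]; apply: irrx; exists (r + (Num.floor x^-1)%:~R)^-1 => //.
  by rewrite fmorphV rmorphD /= ratr_int rE /gauss_map subrK invrK.
split=> //; have /andP[fl fu] := floor_itv x^-1.
rewrite intrD1 in fu.
rewrite lt_neqAle /gauss_map subr_ge0 fl ltrBlDl fu !andbT eq_sym.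
apply/eqP => g0; apply: irrg; rewrite /gauss_map g0.
by exists 0 => //; rewrite raddf0.
Qed.

Lemma orbit_itv x n : 0 < x < 1 -> irrational x ->
  0 < orbit n x < 1 /\ irrational (orbit n x).
Proof.
by move=> x01 irrx; elim: n => [//|n [IH01 irr]]; exact: gauss_map_itv.
Qed.

Lemma cf_digitE x n : 0 < x < 1 -> irrational x ->
  (orbit n x)^-1 = (cf_digit x n.+1)%:R + orbit n.+1 x.
Proof.
move=> x01 irrx; have [/andP[t0 t1] _] := orbit_itv n x01 irrx.
rewrite /cf_digit [orbit n.+1 x]/= /gauss_map truncn_floor invr_ge0 (ltW t0).
have fl0 : 0 <= Num.floor (orbit n x)^-1 by rewrite floor_ge_int invr_ge0 ltW.
by rewrite -[X in (X%:~R)](gez0_abs fl0) addrC subrK.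
Qed.

Lemma cf_digit_gt0 x n : 0 < x < 1 -> irrational x -> (0 < cf_digit x n.+1)%N.
Proof.
move=> x01 irrx; have [/andP[t0 t1] _] := orbit_itv n x01 irrx.
by rewrite truncn_gt0 invf_ge1// ltW.
Qed.

Lemma moebius_orbit x n : 0 < x < 1 -> irrational x ->
  x = moebius (cf_digit x) n (orbit n x).
Proof.
move=> x01 irrx; have dgt0 i := cf_digit_gt0 i x01 irrx.
elim: n => [|n IHn]; first by rewrite /moebius /= add0r mulr0 mulr1 addr0 divr1.
have [/andP[t0 _] _] := orbit_itv n.+1 x01 irrx.
by rewrite (moebiusS dgt0) ?(ltW t0)// -cf_digitE// invrK.
Qed.

(* The converse of [moebius_orbit]: the representation determines the digits,
   so two depth-[n] intervals that meet coincide. *)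
Lemma moebius_digits (a : nat -> nat) x n t :
  (forall i, (0 < a i.+1)%N) -> 0 < t < 1 -> x = moebius a n t ->
  orbit n x = t /\ forall i, (i < n)%N -> cf_digit x i.+1 = a i.+1.
Proof.
move=> agt0; elim: n t => [|n IHn] t /andP[t0 t1].
  by rewrite /moebius /= add0r mulr0 mulr1 addr0 divr1.
have a1 : 1 <= (a n.+1)%:R :> R by rewrite ler1n.
(* The induction hypothesis is applied to the inverse of this number, which must lie in (0, 1). *)
have at1 : 1 < (a n.+1)%:R + t by rewrite (le_lt_trans a1)// ltrDl.
rewrite (moebiusS agt0) ?(ltW t0)// => /IHn [].
  by rewrite invr_gt0 (lt_trans ltr01 at1) invf_lt1// (lt_trans ltr01 at1).
move=> oE dE.
have dnE : cf_digit x n.+1 = a n.+1.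
  rewrite /cf_digit /= oE invrK; apply: truncn_def.
  by rewrite lerDl (ltW t0) -natr1 ltrD2l.
split; last by move=> i; rewrite ltnS leq_eqVlt => /predU1P[->//|/dE].
have flE : Num.floor ((a n.+1)%:R + t) = (a n.+1)%:Z.
  by apply: floor_def; rewrite -[_%:~R]/((a n.+1)%:R) lerDl (ltW t0) intrD ltrD2l.
by rewrite /= oE /gauss_map invrK flE -[_%:~R]/((a n.+1)%:R) addrAC subrr add0r.
Qed.

Lemma cf_intervalP x y n : 0 < y < 1 -> irrational y ->
  cf_interval y n x <-> between (cf_digit y) n x.
Proof.
move=> y01 irry; have dgt0 i := cf_digit_gt0 i y01 irry.
case: n => [|n].
  (* With p_(-1) = 1 and q_(-1) = 0, the two conditions read [0 < x] and [x < 1]. *)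
  by rewrite /between /= expr0 !mul1r !mulr1 subr0 in_itv subr_gt0.
rewrite /between /cf_interval /cf_p /cf_q [cf_prev _ 1 0 n.+1]/= [cf_prev _ 0 1 n.+1]/=.
have := cf_det R (cf_digit y) n.+1.
have Q0 := cf_q_gt0 dgt0 n.+1.
rewrite [cf_prev _ 1 0 n.+1]/= [cf_prev _ 0 1 n.+1]/=.
move: (cf_rec _ 1 0 n.+1) (cf_rec _ 0 1 n.+1) Q0 => p q q0.
move: (cf_rec _ 1 0 n) (cf_rec _ 0 1 n) => p' q' det.
have q0R : 0 < q%:R :> R by rewrite ltr0n.
have qq0R : 0 < (q + q')%N%:R :> R by rewrite ltr0n addn_gt0 q0.
(* After cross-multiplication, the order of the endpoints is the sign of the determinant, hence the
   parity of the depth. *)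
have ab : (p%:R / q%:R < (p + p')%N%:R / (q + q')%N%:R :> R)
    = (0 < p'%:R * q%:R - p%:R * q'%:R :> R).
  rewrite ltr_pdivrMr// mulrAC ltr_pdivlMr// -subr_gt0 !natrD; congr (0 < _).
  ring.
have ba : ((p + p')%N%:R / (q + q')%N%:R < p%:R / q%:R :> R)
    = (0 < - (p'%:R * q%:R - p%:R * q'%:R) :> R).
  rewrite ltr_pdivrMr// mulrAC ltr_pdivlMr// -subr_gt0 !natrD; congr (0 < _).
  ring.
move: ab ba; rewrite det -signr_odd; case: (odd _); rewrite ?expr1 ?expr0 ?opprK.
  rewrite ltr01 => _ ba; rewrite (min_r (ltW ba)) (max_l (ltW ba)) /= in_itv /=.
  rewrite ltr_pdivrMr// ltr_pdivlMr// !mulN1r !opprB !subr_gt0.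
  by rewrite andbC.
rewrite ltr01 => ab _; rewrite (min_l (ltW ab)) (max_r (ltW ab)) /= in_itv /=.
by rewrite ltr_pdivrMr// ltr_pdivlMr// !mul1r !subr_gt0.
Qed.

End GaussOrbit.

(** * Continued fraction intervals around [x] *)

Section Cylinders.
Set Implicit Arguments.
Unset Strict Implicit.
Variable R : realType.
Implicit Types (x y : R) (n l : nat).

Lemma cf_interval_self x n : 0 < x < 1 -> irrational x -> cf_interval x n x.
Proof.
move=> x01 irrx; apply/cf_intervalP => //.
rewrite {2}(moebius_orbit n x01 irrx); apply: moebius_between.
  by move=> i; exact: cf_digit_gt0.
by have [] := orbit_itv n x01 irrx.
Qed.

(** The interval depends only on the first [n] digits of [y], and [x] shares them by
    [moebius_digits]. *)
Lemma eq_cf_interval x y n : 0 < y < 1 -> irrational y ->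
  cf_interval y n x -> cf_interval y n = cf_interval x n.
Proof.
move=> y01 irry; have dgt0 i := cf_digit_gt0 i y01 irry.
case/(cf_intervalP _ _ y01 irry)/(between_moebius dgt0) => t t01.
move/(moebius_digits dgt0 t01) => [_]; case: n => [//|n] dE.
have dE' i : (i < n)%N -> cf_digit x i.+1 = cf_digit y i.+1.
  by move=> lin; apply: dE; rewrite ltnS ltnW.
have [pS _] := eq_cf_rec 1 0 dE; have [qS _] := eq_cf_rec 0 1 dE.
have [p _] := eq_cf_rec 1 0 dE'; have [q _] := eq_cf_rec 0 1 dE'.
by rewrite /cf_interval /cf_p /cf_q pS qS p q.
Qed.

Lemma interval_of_CF x n : 0 < x < 1 -> irrational x ->
  interval_of (CF n) x = cf_interval x n.
Proof.
move=> x01 irrx; apply/seteqP; split => [z [I [[y [y01 irry] <-] yx]]|z xz].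
  by rewrite (eq_cf_interval y01 irry yx).
exists (cf_interval x n) => //=; split; first by exists x.
exact: cf_interval_self.
Qed.

(** * Farey points and the Farey interval of [x] *)

Lemma farey_points_frac n (p q : nat) : (p <= q <= n.+1)%N -> (0 < q)%N ->
  farey_points n (p%:R / q%:R : R).
Proof.
move=> /andP[lepq leqn] q0.
have g0 : (0 < gcdn p q)%N by rewrite gcdn_gt0 q0 orbT.
have pE : (p = p %/ gcdn p q * gcdn p q)%N by rewrite divnK ?dvdn_gcdl.
have qE : (q = q %/ gcdn p q * gcdn p q)%N by rewrite divnK ?dvdn_gcdr.
(* Reduction to lowest terms does not increase the denominator. *)
exists (p %/ gcdn p q)%N, (q %/ gcdn p q)%N; split.
- by rewrite leq_div2r//= (leq_trans (leq_div _ _)).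
- by rewrite divn_gt0// dvdn_leq// dvdn_gcdr.
- by rewrite /coprime -(eqn_pmul2r g0) mul1n muln_gcdl -pE -qE.
- rewrite {1}qE {1}pE !natrM invfM mulrACA divff ?mulr1//.
  by rewrite pnatr_eq0 -lt0n.
Qed.

Lemma farey_points_neq n x c : irrational x -> farey_points n c -> c != x.
Proof.
move=> irrx [p [q [_ _ _ ->]]]; apply/eqP => cx; apply: irrx.
by exists (p%:R / q%:R) => //; rewrite fmorph_div !rmorph_nat.
Qed.

Lemma farey_cell n x : 0 < x < 1 -> irrational x ->
  exists a b, [/\ farey_points n a, farey_points n b, a < x < b &
    forall c, farey_points n c -> ~~ (a < c < b)].
Proof.
move=> /andP[x0 x1] irrx.
(* Possibly unreduced fractions over a finite index type exhaust the Farey points, so the nearest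
   one on each side of [x] exists. *)
pose F (i : 'I_n.+2 * 'I_n.+2) : R := i.1%:R / i.2%:R.
pose D (i : 'I_n.+2 * 'I_n.+2) := (i.1 <= i.2)%N && (0 < i.2)%N.
have DF i : D i -> farey_points n (F i).
  by move=> /andP[le12 i2]; apply: farey_points_frac; rewrite // le12 -ltnS /=.
have FD c : farey_points n c -> exists2 i, D i & c = F i.
  move=> [p [q [/andP[lepq leqn] q0 _ ->]]].
  have ltqn : (q < n.+2)%N by rewrite ltnS.
  exists (Ordinal (leq_ltn_trans lepq ltqn), Ordinal ltqn) => //.
  by rewrite /D lepq.
(* The points 0/1 and 1/1 make both searches nonempty. *)
have lo : D (ord0, inord 1) && (F (ord0, inord 1) < x).
  by rewrite /D /F /= inordK // mul0r x0.
have hi : D (inord 1, inord 1) && (x < F (inord 1, inord 1)).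
  by rewrite /D /F /= inordK // divr1 x1.
case: (@arg_maxP _ R _ _ (fun i => D i && (F i < x)) F lo) => i /andP[Di ix] maxi.
case: (@arg_minP _ R _ _ (fun i => D i && (x < F i)) F hi) => j /andP[Dj xj] minj.
exists (F i), (F j); split; [exact: DF|exact: DF|by rewrite ix|move=> c fc].
have := farey_points_neq irrx fc; have [k Dk ->] := FD c fc.
rewrite neq_lt negb_and -!leNgt => /orP[kx|xk]; apply/orP; [left|right].
  by apply: maxi; rewrite Dk.
by apply: minj; rewrite Dk.
Qed.

(** * Comparison of Farey intervals with continued fraction intervals *)

Lemma farey_sub_cf_interval n x l : 0 < x < 1 -> irrational x ->
  (cf_q x l.+1 + cf_q x l <= n.+1)%N ->
  (interval_of (Farey n) x `<=` cf_interval x l.+1)%classic.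
Proof.
move=> x01 irrx len z [I [[a [b [_ _ _ nofarey ->]]]] Ix Iz].
rewrite /= in_itv in Ix; have /andP[ax xb] := Ix.
rewrite /= in_itv in Iz; have /andP[az zb] := Iz.
have dgt0 i := cf_digit_gt0 i x01 irrx.
(* No Farey point separates [x] from [z]. The factor [e] carries the orientation, so one statement
   covers both endpoints and both parities. *)
have side (e : R) (p q : nat) : (0 < q)%N -> farey_points n (p%:R / q%:R : R) ->
    0 < e * (x * q%:R - p%:R) -> 0 < e * (z * q%:R - p%:R).
  move=> q_gt0 /nofarey; have q0 : 0 < q%:R :> R by rewrite ltr0n.
  have clear_den (w : R) : w * q%:R - p%:R = (w - p%:R / q%:R) * q%:R.
    by rewrite mulrBl divfK// lt0r_neq0.
  rewrite !clear_den !mulrA ![0 < _ * q%:R]pmulr_lgt0//.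
  move: (p%:R / q%:R) => c.
  rewrite negb_and -!leNgt => /orP[ca|bc] exc.
    rewrite pmulr_lgt0 ?subr_gt0 ?(le_lt_trans ca)//.
    by rewrite pmulr_lgt0 ?subr_gt0 ?(le_lt_trans ca) in exc.
  rewrite nmulr_lgt0 ?subr_lt0 ?(lt_le_trans _ bc)//.
  by rewrite nmulr_lgt0 ?subr_lt0 ?(lt_le_trans _ bc) in exc.
have q0 : (0 < cf_q x l.+1)%N by exact: cf_q_gt0.
have [pql pqS] := leq_cf_p_q dgt0 l.
have fP : farey_points n ((cf_p x l.+1)%:R / (cf_q x l.+1)%:R : R).
  by apply: farey_points_frac; rewrite // pqS (leq_trans (leq_addr _ _) len).
have fS : farey_points n
    ((cf_p x l.+1 + cf_p x l)%N%:R / (cf_q x l.+1 + cf_q x l)%N%:R : R).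
  by apply: farey_points_frac; [rewrite leq_add|rewrite addn_gt0 q0].
have /(cf_intervalP _ _ x01 irrx) /andP[x1 x2] := cf_interval_self l.+1 x01 irrx.
apply/(cf_intervalP _ _ x01 irrx); apply/andP; split; first exact: side x1.
rewrite -mulrNN opprB; apply: side => //; first by rewrite addn_gt0 q0.
by rewrite mulNr -mulrN opprB.
Qed.

Lemma farey_nsub_cf_interval n x l : 0 < x < 1 -> irrational x ->
  (n.+1 < cf_q x l.+1 + cf_q x l)%N ->
  ~ (interval_of (Farey n) x `<=` cf_interval x l.+1)%classic.
Proof.
move=> x01 irrx ltn sub.
have dgt0 i := cf_digit_gt0 i x01 irrx.
have [a [b [fa fb axb nofarey]]] := farey_cell n x01 irrx.
have /andP[ax xb] := axb; have ab := lt_trans ax xb.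
have Fab z : a < z < b -> between (cf_digit x) l.+1 z.
  move=> azb; apply/(cf_intervalP _ _ x01 irrx); apply: sub.
  exists `]a, b[%classic; last by rewrite /= in_itv.
  by split; [exists a, b|rewrite /= in_itv].
have /andP[x1 x2] := Fab x axb.
move: x1 x2; set e : R := (-1) ^+ l.+1.
set p2 := (_ + _)%N; set q2 := (_ + cf_prev _ 0 1 _)%N.
set p := (cf_rec _ 1 0 l.+1)%:R; set q := (cf_rec _ 0 1 l.+1)%:R => x1 x2.
have q0 : 0 < q by rewrite ltr0n (cf_q_gt0 dgt0).
have q20 : 0 < q2%:R :> R by rewrite ltr0n addn_gt0 (cf_q_gt0 dgt0).
have rE (w : R) : p2%:R - w * q2%:R = (p2%:R / q2%:R - w) * q2%:R.
  by rewrite mulrBl divfK// lt0r_neq0.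
set r : R := p2%:R / q2%:R in rE.
rewrite rE mulrA pmulr_lgt0// in x2.
(* No Farey point lies between [x] and [r], [r] included: by [between_den] its denominator would
   exceed [n.+1]. *)
have large c : farey_points n c -> 0 <= e * (c - x) -> ~ 0 <= e * (r - c).
  move=> [u [v [/andP[_ levn] v0 _ cE]]] c1 c2.
  have := leq_ltn_trans levn ltn; rewrite ltnNge => /negP; apply.
  apply: (between_den _ _ v0 cE); last first.
    by rewrite -/p2 -/q2 rE mulrA mulr_ge0// ltW.
  rewrite -/p -/q -/e.
  rewrite (_ : e * _ = e * (x * q - p) + e * (c - x) * q); last by ring.
  by rewrite ltr_wpDr// mulr_ge0// ltW.
(* The mediant [r] is an endpoint of the depth-[l.+1] interval. *)
have : ~~ (a < r < b).
  by apply/negP => /Fab /andP[_]; rewrite -/p2 -/q2 rE subrr mul0r mulr0 ltxx.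
(* The endpoint of the Farey interval on the side of [r] lies between [x] and [r]; the sign of [e]
   follows from that side. *)
rewrite negb_and -!leNgt => /orP[ra|br].
  rewrite nmulr_lgt0 ?subr_lt0 ?(le_lt_trans ra)// in x2.
  by apply: (large a fa); rewrite nmulr_rge0// subr_le0// ltW.
rewrite pmulr_lgt0 ?subr_gt0 ?(lt_le_trans xb)// in x2.
by apply: (large b fb); rewrite pmulr_rge0// subr_ge0// ltW.
Qed.

End Cylinders.

Theorem proposition5p5 (R : realType) (x : R) (n k : nat)
    (x01 : 0 < x < 1) (irrx : irrational x) (n_gt0 : (0 < n)%N)
    (k_gt0 : (0 < k)%N)
    (hk : (cf_q x k + cf_q x k.-1 <= n.+1 < cf_q x k.+1 + cf_q x k)%N) :
  Lochs_index n x Farey CF = (k%:R)%:E.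
Proof.
have /andP[lekn ltnk] := hk; have dgt0 i := cf_digit_gt0 i x01 irrx.
apply/eqP; rewrite eq_le; apply/andP; split.
  apply: ge_ereal_sup => _ [l /= + <-]; rewrite lee_fin ler_nat interval_of_CF//.
  (* Depth 0 cannot exceed [k]. At a depth above [k], monotonicity keeps the sum of the two
     denominators above [n.+1]. *)
  case: l => [//|l] sub; rewrite leqNgt; apply/negP; rewrite ltnS => lekl.
  apply: (farey_nsub_cf_interval x01 irrx _ sub).
  exact: leq_trans ltnk (leq_cf_q_sum dgt0 lekl).
(* The supremum is attained at [k], which is positive, so that [k.-1] is a true predecessor. *)
apply: ereal_sup_ubound; exists k => //=; rewrite interval_of_CF//.
case: k k_gt0 lekn {hk ltnk} => // k _ lekn.
exact: farey_sub_cf_interval.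
Qed.
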